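(* Let $G$ be a finite simple graph with non-negative edge weights and let $\widetilde{G}$ be any vertex-split graph of $G$. Then $G$ is exact if and only if $\widetilde{G}$ is exact.
   Context: Given a weighted graph $G=(V,E,\mathbf{w})$ on $n$ vertices and integers $p_i\ge1$, $i\in[n]$, the vertex-split graph $\widetilde{G}$ is obtained by replacing each vertex $i$ with $p_i$ distinct copies; for each edge $ij\in E$ all possible edges are added between the copies of $i$ and the copies of $j$, each with weight $w_{ij}/(p_ip_j)$ (there are no edges among copies of the same vertex). The Laplacian $\mathcal{L}_G$ of a graph $G=(V,E)$ with edge weights $w_{ij}$ ($w_{ij}=0$ for non-edges) is the $V\times V$ matrix with off-diagonal entries $-w_{ij}$ and diagonal entries $\sum_{j\ne i}w_{ij}$. The MAXCUT SDP of $G$ is: maximize $\frac14\langle \mathcal{L}_G,\mathbf{X}\rangle$ over symmetric matrices $\mathbf{X}\in\mathbb{R}^{V\times V}$ with $X_{ii}=1$ for all $i\in V$ and $\mathbf{X}\succeq \mathbf{0}$, where $\langle \mathbf{A},\mathbf{B}\rangle=\operatorname{tr}(\mathbf{A}\mathbf{B})$. $\mathrm{MAXCUT}(G)$ is the maximum, over partitions $(S,V\setminus S)$ of $V$, of the total weight of edges with exactly one endpoint in $S$. $G$ is called exact if the optimal value of the MAXCUT SDP of $G$ equals $\mathrm{MAXCUT}(G)$; equivalently, if the MAXCUT SDP has an optimal solution of rank $1$. *)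

(* Defs.v *)
From mathcomp Require Import all_boot all_order all_algebra.
From mathcomp Require Import boolp classical_sets reals.
From mathcomp Require Import ring lra.

Set Implicit Arguments.
Unset Strict Implicit.
Unset Printing Implicit Defensive.

Import Order.TTheory GRing.Theory Num.Theory.
Local Open Scope ring_scope.

(* A weight may vanish on an edge, so the edge relation is separate data.
   Non-negativity of the weights is not part of the structure. *)
Record wgraph (R : realType) (V : finType) := WGraph {
  edge : rel V;
  weight : V -> V -> R;
  edge_sym : symmetric edge;
  edge_irr : irreflexive edge;
  weight_sym : forall i j, weight i j = weight j i;
  weight_nonedge : forall i j, ~~ edge i j -> weight i j = 0
}.

Section Maxcut.
Variables (R : realType) (V : finType).
Implicit Type G : wgraph R V.

(* V x V matrices are indexed by 'I_#|V| along [enum_val]. *)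
Definition laplacian G : 'M[R]_#|V| :=
  \matrix_(i, j)
    (if i == j then \sum_(k | k != enum_val i) weight G (enum_val i) k
     else - weight G (enum_val i) (enum_val j)).

Definition psdmx n (X : 'M[R]_n) : Prop :=
  X^T = X /\ forall v : 'cV[R]_n, 0 <= (v^T *m X *m v) 0 0.

Definition elliptope n : set 'M[R]_n :=
  [set X : 'M[R]_n | psdmx X /\ forall i, X i i = 1]%classic.

Definition maxcut_obj G (X : 'M[R]_#|V|) : R :=
  4^-1 * \tr (laplacian G *m X).

(* The supremum is over a nonempty bounded set, see [has_sup_maxcut_obj]. *)
Definition maxcut_sdp G : R :=
  sup [set maxcut_obj G X | X in elliptope (n := #|V|)]%classic.

(* Each edge across (S, ~: S) is counted once, oriented out of S. *)
Definition cut_weight G (S : {set V}) : R :=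
  \sum_(i in S) \sum_(j in ~: S | edge G i j) weight G i j.

(* The default value 0 is the weight of the trivial cut S = set0. *)
Definition maxcut G : R := \big[Num.max/0]_(S : {set V}) cut_weight G S.

Definition exact_graph G : Prop := maxcut_sdp G = maxcut G.

Lemma elliptope_const n : elliptope (const_mx 1 : 'M[R]_n).
Proof.
split; last by move=> i; rewrite mxE.
split=> [|v]; first by apply/matrixP => i j; rewrite !mxE.
pose u : 'cV[R]_n := const_mx 1.
have -> : const_mx 1 = u *m u^T.
  by apply/matrixP => i j; rewrite !mxE big_ord1 !mxE mulr1.
have -> : v^T *m (u *m u^T) *m v = (u^T *m v)^T *m (u^T *m v).
  by rewrite trmx_mul trmxK !mulmxA.
by rewrite mxE big_ord1 mxE -expr2 sqr_ge0.
Qed.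

Lemma elliptope_le1 n (X : 'M[R]_n) i j : elliptope X -> `|X i j| <= 1.
Proof.
case=> -[Xsym Xpsd] Xdiag.
pose e k : 'cV[R]_n := delta_mx k 0.
have q a b : ((e a)^T *m X *m e b) 0 0 = X a b.
  by rewrite /e trmx_delta -mulmxA -rowE -colE !mxE.
have Xji : X j i = X i j by rewrite -[in LHS]Xsym mxE.
have qc c : ((e i + c *: e j)^T *m X *m (e i + c *: e j)) 0 0 =
            X i i + c * X i j + c * (X j i + c * X j j).
  rewrite [(_ + _)^T]linearD /= [(_ *: _)^T]linearZ /=.
  rewrite !mulmxDl !mulmxDr -!scalemxAl -!scalemxAr -!q.
  have D (A B : 'M[R]_1) : (A + B) 0 0 = A 0 0 + B 0 0 by rewrite mxE.
  have Z a (A : 'M[R]_1) : (a *: A) 0 0 = a * A 0 0 by rewrite mxE.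
  by rewrite !(D, Z); ring.
have := Xpsd (e i + 1 *: e j); have := Xpsd (e i + (-1) *: e j).
by rewrite !qc Xji !Xdiag ler_norml => *; lra.
Qed.

Lemma has_sup_maxcut_obj G :
  has_sup [set maxcut_obj G X | X in elliptope (n := #|V|)]%classic.
Proof.
split; first by exists (maxcut_obj G (const_mx 1)), (const_mx 1);
  first exact: elliptope_const.
exists (4^-1 * \sum_i \sum_j `|laplacian G i j|) => _ [X Xell <-].
rewrite ler_wpM2l ?invr_ge0 //; apply: ler_sum => i _.
rewrite mxE; apply: ler_sum => j _; apply: le_trans (ler_norm _) _.
by rewrite normrM ler_piMr // elliptope_le1.
Qed.

End Maxcut.

Section VertexSplit.
Variables (R : realType) (V : finType) (G : wgraph R V) (p : V -> nat).

(* [Tagged _ a], with a : 'I_(p i), is the a-th copy of the vertex i. *)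
Definition split_vertex : finType := {i : V & 'I_(p i)}.

Definition split_edge : rel split_vertex :=
  fun u v => edge G (tag u) (tag v).

Definition split_weight (u v : split_vertex) : R :=
  weight G (tag u) (tag v) / ((p (tag u))%:R * (p (tag v))%:R).

Lemma split_edge_sym : symmetric split_edge.
Proof. by move=> u v; apply: edge_sym. Qed.

Lemma split_edge_irr : irreflexive split_edge.
Proof. by move=> u; apply: edge_irr. Qed.

Lemma split_weight_sym u v : split_weight u v = split_weight v u.
Proof. by rewrite /split_weight weight_sym mulrC [X in X^-1]mulrC mulrC. Qed.

Lemma split_weight_nonedge u v : ~~ split_edge u v -> split_weight u v = 0.
Proof. by move=> /weight_nonedge e0; rewrite /split_weight e0 mul0r. Qed.

Definition vertex_split : wgraph R split_vertex :=
  WGraph split_edge_sym split_edge_irr split_weight_sym split_weight_nonedge.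

End VertexSplit.

(* Main.v *)
Require Import Defs.
From mathcomp Require Import all_boot all_order all_algebra.
From mathcomp Require Import boolp reals.
From mathcomp Require Import ring.
Import Order.TTheory GRing.Theory Num.Theory.
Local Open Scope ring_scope.

(** Both optimal values are unchanged by vertex splitting, so equality of the
    two is unchanged as well.

    The SDP objective and the cut weight are two instances of one expression,
    the energy [\sum_i \sum_j w_ij * K i j] of a kernel [K]: the kernel is
    [(1 - X i j) / 4] for a matrix [X] of the elliptope, and the indicator of
    [i \in S] and [j \notin S] for a cut [S].  Both families of kernels are
    stable under pulling back along an arbitrary map of vertices.  Hence if
    every kernel on [H] can be pulled back to [G] without losing energy, both
    optimal values of [H] are at most those of [G]
    ([maxcut_sdp_le], [maxcut_le]).

    From [G] to the split graph, the pullback is along the projection sending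
    a copy to its original.  In the other direction it is along a section,
    that is, a choice of one copy of every vertex.  If the section is random
    and uniform, the copies chosen for two distinct vertices [i] and [j] are
    independent and uniform, so the expected energy of the pullback is the
    energy on the split graph, because the weight of an edge between copies
    is exactly [w_ij / (p_i p_j)] ([sum_energy_section]); some section does at
    least as well as the average.  The averaging identity also gives the
    first direction, since a kernel that is constant on copies pulls back to
    the same kernel along every section. *)

(** The sum runs over ordered pairs: an edge [ij] contributes both [K i j] and
    [K j i].  The cut kernel vanishes for at least one of the two orientations,
    and the SDP kernel is symmetric, so it has the factor [1/4] in place of the
    [1/2] of a sum over edges. *)
Definition energy {R : realType} {V : finType} (G : wgraph R V)
    (K : V -> V -> R) : R :=
  \sum_i \sum_j weight G i j * K i j.

Definition energy_dominated {R : realType} {V W : finType}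
    (H : wgraph R W) (G : wgraph R V) : Prop :=
  forall K : W -> W -> R, exists phi : V -> W,
    energy H K <= energy G (fun i j => K (phi i) (phi j)).

Lemma weight_diag {R : realType} {V : finType} (G : wgraph R V) i :
  weight G i i = 0.
Proof. by apply: weight_nonedge; rewrite edge_irr. Qed.

Lemma cut_weight_energy {R : realType} {V : finType} (G : wgraph R V)
    (S : {set V}) :
  cut_weight G S = energy G (fun i j => ((i \in S) && (j \notin S))%:R).
Proof.
rewrite /cut_weight /energy big_mkcond /=; apply: eq_bigr => i _.
case: ifP => iS; last by rewrite big1 // => j _; rewrite mulr0.
rewrite big_mkcond /=; apply: eq_bigr => j _; rewrite inE.
case: (boolP (edge G i j)) => [_|/weight_nonedge ->]; last first.
  by rewrite mul0r andbF.
by rewrite andbT; case: (j \in S); rewrite ?mulr0 ?mulr1.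
Qed.

(** The unit diagonal turns the degree [L i i] into the sum of the
    [w_ij * 1], hence the factor [1 - X i j]. *)
Lemma maxcut_obj_energy {R : realType} {V : finType} (G : wgraph R V)
    (X : 'M[R]_#|V|) :
  elliptope X ->
  maxcut_obj G X =
    energy G (fun i j => 4^-1 * (1 - X (enum_rank i) (enum_rank j))).
Proof.
case=> -[Xsym _] Xdiag; rewrite /maxcut_obj /energy /mxtrace mulr_sumr.
rewrite (reindex _ (onW_bij _ (@enum_rank_bij V))) /=.
apply: eq_bigr => i _; rewrite mxE.
rewrite (reindex _ (onW_bij _ (@enum_rank_bij V))) /=.
have -> : \sum_j laplacian G (enum_rank i) (enum_rank j)
                  * X (enum_rank j) (enum_rank i) =
          \sum_j weight G i j * (1 - X (enum_rank i) (enum_rank j)).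
  rewrite (bigD1 i) //= [RHS](bigD1 i) //= weight_diag mul0r add0r.
  rewrite mxE eqxx Xdiag mulr1 enum_rankK -big_split /=.
  apply: eq_bigr => j ji; rewrite mxE (inj_eq enum_rank_inj) eq_sym.
  have -> : X (enum_rank j) (enum_rank i) = X (enum_rank i) (enum_rank j).
    by rewrite -[in LHS]Xsym mxE.
  by rewrite (negPf ji) !enum_rankK; ring.
by rewrite mulr_sumr; apply: eq_bigr => j _; ring.
Qed.

(** [mxsub g g X] is the Gram matrix of the vectors of [X] reindexed by [g]:
    its quadratic form is that of [X] precomposed with a linear map. *)
Lemma elliptope_mxsub {R : realType} m n (g : 'I_n -> 'I_m) (X : 'M[R]_m) :
  elliptope X -> elliptope (mxsub g g X).
Proof.
case=> -[Xsym Xpsd] Xdiag; split; last by move=> i; rewrite mxE.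
split=> [|v].
  by apply/matrixP => i j; rewrite !mxE -[in LHS]Xsym mxE.
pose B : 'M[R]_(m, n) := colsub g 1%:M.
have -> : mxsub g g X = B^T *m X *m B.
  have -> : B^T = rowsub g 1%:M.
    by apply/matrixP => i j; rewrite !mxE eq_sym.
  rewrite -rowsubE mulmx_colsub mulmx1.
  by apply/matrixP => i j; rewrite !mxE.
have -> : v^T *m (B^T *m X *m B) *m v = (B *m v)^T *m X *m (B *m v).
  by rewrite trmx_mul !mulmxA.
exact: Xpsd.
Qed.

Lemma maxcut_sdp_le {R : realType} {V W : finType}
    (H : wgraph R W) (G : wgraph R V) :
  energy_dominated H G -> maxcut_sdp H <= maxcut_sdp G.
Proof.
move=> domHG; apply: ge_sup; first by case: (has_sup_maxcut_obj H).
move=> _ [X Xell <-]; rewrite maxcut_obj_energy //.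
have [phi /le_trans] :=
  domHG (fun u v => 4^-1 * (1 - X (enum_rank u) (enum_rank v))).
apply; pose g (i : 'I_#|V|) := enum_rank (phi (enum_val i)).
pose Y := mxsub g g X.
have Yell : elliptope Y by apply: elliptope_mxsub.
have -> : energy G (fun i j =>
    4^-1 * (1 - X (enum_rank (phi i)) (enum_rank (phi j)))) = maxcut_obj G Y.
  rewrite maxcut_obj_energy //; apply: eq_bigr => i _; apply: eq_bigr => j _.
  by rewrite mxE /g !enum_rankK.
by apply: ub_le_sup; [case: (has_sup_maxcut_obj G) | exists Y].
Qed.

Lemma maxcut_le {R : realType} {V W : finType}
    (H : wgraph R W) (G : wgraph R V) :
  energy_dominated H G -> maxcut H <= maxcut G.
Proof.
move=> domHG.
have cut_le S : cut_weight G S <= maxcut G by apply: le_bigmax.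
have maxcut_ge0 : 0 <= maxcut G.
  by have := cut_le set0; rewrite /cut_weight big_set0.
apply: bigmax_le => // S _; rewrite cut_weight_energy.
have [phi /le_trans] := domHG (fun u v => ((u \in S) && (v \notin S))%:R).
apply; have := cut_le [set i | phi i \in S]; rewrite cut_weight_energy.
congr (_ <= _); apply: eq_bigr => i _; apply: eq_bigr => j _.
by rewrite !inE.
Qed.

(** Sections are plain functions into the type of all copies, restricted by
    membership in a family, so that they are counted by [card_family]. *)
Definition fiber {V : finType} {p : V -> nat} (i : V) :
    simpl_pred (split_vertex p) :=
  [pred u | tag u == i].

Definition sections {V : finType} (p : V -> nat) :
    pred {ffun V -> split_vertex p} :=
  family (@fiber V p).

Lemma tag_section {V : finType} {p : V -> nat} (f : {ffun V -> split_vertex p})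
    i : f \in sections p -> tag (f i) = i.
Proof. by move=> /familyP /(_ i) /eqP. Qed.

Lemma card_fiber {V : finType} {p : V -> nat} (i : V) :
  #|@fiber V p i| = p i.
Proof.
have tagged_inj : injective (fun a : 'I_(p i) => Tagged (fun k => 'I_(p k)) a).
  by move=> a b /eqP; rewrite eq_Tagged => /eqP.
rewrite -[RHS]card_ord -(card_image tagged_inj); apply: eq_card => u.
apply/idP/imageP => [/eqP ui|[a _ ->]]; last exact: eqxx.
by case: u ui => j a /= ji; case: _ / ji; exists a.
Qed.

Lemma card_family_prod {T : finType} {T' : finType} (F : T -> pred T') :
  #|family F| = (\prod_x #|F x|)%N.
Proof. by rewrite card_family foldrE big_map big_enum. Qed.

Lemma card_sections_gt0 {V : finType} (p : V -> nat) :
  (forall i, 1 <= p i)%N -> (0 < #|sections p|)%N.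
Proof.
move=> p_ge1; rewrite card_family_prod prodn_gt0 // => i.
by rewrite card_fiber.
Qed.

(** Independence of the copies chosen for two distinct vertices: fixing both
    choices replaces two factors of the product counting sections by 1. *)
Lemma card_sections_through {V : finType} {p : V -> nat}
    (u v : split_vertex p) :
  tag u != tag v ->
  (#|[pred f | (f \in sections p) && ((f (tag u) == u) && (f (tag v) == v))]|
     * (p (tag u) * p (tag v)))%N = #|sections p|.
Proof.
move=> uv; pose F k : simpl_pred (split_vertex p) :=
  if k == tag u then pred1 u else if k == tag v then pred1 v else fiber k.
have vu : tag v == tag u = false by rewrite eq_sym (negPf uv).
have -> : #|[pred f | (f \in sections p) &&
                      ((f (tag u) == u) && (f (tag v) == v))]| = #|family F|.
  apply: eq_card => f; rewrite inE; apply/idP/familyP => [|Ff].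
    case/and3P => fs /eqP fu /eqP fv k; rewrite /F.
    case: eqP => [->|_]; first by rewrite fu; exact: eqxx.
    case: eqP => [->|_]; first by rewrite fv; exact: eqxx.
    by rewrite inE; apply/eqP; apply: tag_section.
  have fu : f (tag u) == u by move: (Ff (tag u)); rewrite /F eqxx.
  have fv : f (tag v) == v by move: (Ff (tag v)); rewrite /F eqxx vu.
  rewrite fu fv !andbT; apply/familyP => k; have := Ff k; rewrite /F.
  case: eqP => [-> _|_]; first by rewrite (eqP fu) inE.
  by case: eqP => [-> _|//]; rewrite (eqP fv) inE.
have F_other k : k != tag u -> k != tag v -> F k = fiber k.
  by move=> /negPf ku /negPf kv; rewrite /F ku kv.
rewrite !card_family_prod (bigD1 (tag u)) //= (bigD1 (tag v)) /=; last first.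
  by rewrite vu.
rewrite [RHS](bigD1 (tag u)) //=.
rewrite [in RHS](bigD1 (tag v)) /=; last by rewrite vu.
rewrite !card_fiber {1 2}/F vu !eqxx !card1 !mul1n.
rewrite mulnC -mulnA; congr (_ * (_ * _))%N.
by apply: eq_bigr => k /andP[ku kv]; rewrite F_other.
Qed.

(** Exchanging the sums, a pair of copies [u], [v] contributes [K u v] as many
    times as there are sections through both, and this number is the fraction
    [1 / (p_i p_j)] of all sections.  Copies of the same vertex are not
    independent, but they carry no weight. *)
Lemma sum_energy_section {R : realType} {V : finType} (G : wgraph R V)
    (p : V -> nat) (p_ge1 : forall i, (1 <= p i)%N)
    (K : split_vertex p -> split_vertex p -> R) :
  \sum_(f in sections p) energy G (fun i j => K (f i) (f j)) =
    #|sections p|%:R * energy (vertex_split G p) K.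
Proof.
have pullback f : f \in sections p ->
    energy G (fun i j => K (f i) (f j)) =
    \sum_u \sum_v ((f (tag u) == u) && (f (tag v) == v))%:R
                    * (weight G (tag u) (tag v) * K u v).
  move=> fs; rewrite /energy (reindex_onto tag f) /=; last first.
    by move=> i _; apply: tag_section.
  rewrite big_mkcond /=; apply: eq_bigr => u _.
  case: eqP => [fu|_]; last by rewrite big1 // => v _; rewrite mul0r.
  rewrite (reindex_onto tag f) /=; last by move=> i _; apply: tag_section.
  rewrite big_mkcond /=; apply: eq_bigr => v _.
  by case: eqP => [fv|_]; rewrite ?mul0r // mul1r fu fv.
rewrite (eq_bigr _ pullback) exchange_big /= mulr_sumr.
apply: eq_bigr => u _; rewrite exchange_big /= mulr_sumr.
apply: eq_bigr => v _; rewrite -mulr_suml -natr_sum /= /split_weight.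
have [uv|uv] := eqVneq (tag u) (tag v).
  by rewrite uv weight_diag !mul0r !mulr0.
rewrite -(card_sections_through u v uv) natrM natrM.
rewrite -[in RHS]sum1_card big_mkcondr /=.
rewrite [in RHS](eq_bigr (fun f : {ffun V -> split_vertex p} =>
  nat_of_bool ((f (tag u) == u) && (f (tag v) == v)))); last first.
  by move=> f _; case: (_ && _).
have pu : (p (tag u))%:R != 0 :> R by rewrite pnatr_eq0 -lt0n.
have pv : (p (tag v))%:R != 0 :> R by rewrite pnatr_eq0 -lt0n.
by field; rewrite pu pv.
Qed.

Lemma energy_dominated_split {R : realType} {V : finType} (G : wgraph R V)
    (p : V -> nat) (p_ge1 : forall i, (1 <= p i)%N) :
  energy_dominated G (vertex_split G p).
Proof.
move=> K; exists tag; rewrite le_eqVlt; apply/orP; left; apply/eqP.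
have Nneq0 : #|sections p|%:R != 0 :> R.
  by rewrite pnatr_eq0 -lt0n card_sections_gt0.
apply: (mulfI Nneq0); rewrite -sum_energy_section // mulr_natl.
rewrite -sumr_const; apply: eq_bigr => f fs.
by apply: eq_bigr => i _; apply: eq_bigr => j _; rewrite !tag_section.
Qed.

(** The average of the pullbacks along all sections is the energy on the split
    graph, so they cannot all lie strictly below it. *)
Lemma split_energy_dominated {R : realType} {V : finType} (G : wgraph R V)
    (p : V -> nat) (p_ge1 : forall i, (1 <= p i)%N) :
  energy_dominated (vertex_split G p) G.
Proof.
move=> K; apply: contrapT => /forallNP noK.
have : \sum_(f in sections p) energy G (fun i j => K (f i) (f j)) <
       \sum_(f in sections p) energy (vertex_split G p) K.
  apply: ltr_sum; last by move=> f _; rewrite ltNge; apply/negP/noK.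
  have /card_gt0P[f fs] := card_sections_gt0 p p_ge1.
  by apply/hasP; exists f; rewrite ?mem_index_enum.
by rewrite sum_energy_section // sumr_const mulr_natl ltxx.
Qed.

Theorem theorem9 (R : realType) (V : finType) (G : wgraph R V)
    (weight_ge0 : forall i j, edge G i j -> 0 <= weight G i j)
    (p : V -> nat) (p_ge1 : forall i, (1 <= p i)%N) :
  exact_graph G <-> exact_graph (vertex_split G p).
Proof.
have dom_up := energy_dominated_split G p p_ge1.
have dom_down := split_energy_dominated G p p_ge1.
have sdpE : maxcut_sdp G = maxcut_sdp (vertex_split G p).
  by apply/le_anti; rewrite !maxcut_sdp_le.
have cutE : maxcut G = maxcut (vertex_split G p).
  by apply/le_anti; rewrite !maxcut_le.
by rewrite /exact_graph sdpE cutE.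
Qed.
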